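(* Let $\lambda$ be a signature with $N\ge1$ parts, and let $\mathbf w=(w_1,\ldots,w_M)$, $\boldsymbol\theta=(\theta_1,\ldots,\theta_M)$, $\mathbf y=(y_1,y_2,\ldots)$, $\mathbf s=(s_1,s_2,\ldots)$ be sequences of complex numbers. Then $$G_\lambda(\mathbf w;\mathbf y;\boldsymbol\theta;\mathbf s)=\prod_{1\le i<j\le N}\frac{s_i^{-2}y_i-y_j}{y_j-y_i}\;\det\left[\mathsf h_{\lambda_i+N-i,\,j}(\mathbf w;\mathbf y;\boldsymbol\theta;\mathbf s)\right]_{i,j=1}^N,$$ where $$\mathsf h_{k,m}(\mathbf w;\mathbf y;\boldsymbol\theta;\mathbf s)=\frac1{2\pi\mathbf i}\oint_{\gamma'}dz\,\frac{\psi_k(z\mid\mathbf y;\mathbf s)}{y_m-z}\prod_{j=1}^M\frac{z-\theta_j^{-2}w_j}{z-w_j},$$ $$\psi_k(x\mid\mathbf y;\mathbf s)=\frac{y_{k+1}(s_{k+1}^{-2}-1)}{x-s_{k+1}^{-2}y_{k+1}}\prod_{j=1}^k\frac{x-y_j}{x-s_j^{-2}y_j},\qquad k\ge0.$$ Here the positively oriented integration contour $\gamma'$ surrounds all the points $y_j,w_i$ and leaves out all the points $s_j^{-2}y_j$; the parameters are assumed to be such that $\gamma'$ exists.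
   Context: Signatures. A signature with $N$ parts is an integer sequence $\lambda=(\lambda_1\ge\ldots\ge\lambda_N\ge0)$; $\mathcal S(\lambda)=\{\lambda_j+N+1-j:1\le j\le N\}\subset\mathbb Z_{\ge1}$. Vertex weights. For $i_1,j_1,i_2,j_2\in\{0,1\}$ (numbers of paths entering from the bottom, entering from the left, exiting at the top, exiting to the right) put $W(\cdot)=W(\cdot\mid x;y;r;s)$ with $W(0,0;0,0)=1$, $W(1,1;1,1)=\frac{r^{-2}x-y}{s^{-2}y-x}$, $W(1,0;1,0)=\frac{s^{-2}y-r^{-2}x}{s^{-2}y-x}$, $W(0,1;0,1)=\frac{y-x}{s^{-2}y-x}$, $W(1,0;0,1)=\frac{x(r^{-2}-1)}{s^{-2}y-x}$, $W(0,1;1,0)=\frac{y(s^{-2}-1)}{s^{-2}y-x}$, and $W=0$ otherwise. Partition function. A configuration on $\mathbb Z_{\ge1}\times\{1,\ldots,M\}$ consists of vertical edge states $v(i,j)\in\{0,1\}$ ($i\ge1$, $0\le j\le M$; $v(i,j-1)$ is below and $v(i,j)$ above the vertex $(i,j)$) and horizontal edge states $h(i,j)\in\{0,1\}$ ($i\ge0$, $1\le j\le M$; $h(i-1,j)$ is to the left and $h(i,j)$ to the right of $(i,j)$). For $\lambda$ with $N$ parts, $G_\lambda(\mathbf w;\mathbf y;\boldsymbol\theta;\mathbf s)$ is the sum over configurations with $v(i,0)=\mathbf 1_{1\le i\le N}$, $v(i,M)=\mathbf 1_{i\in\mathcal S(\lambda)}$, $h(0,j)=0$, and $h(i,j)=0$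 for all large $i$, of $\prod_{i\ge1}\prod_{j=1}^MW(v(i,j-1),h(i-1,j);v(i,j),h(i,j)\mid w_j;y_i;\theta_j;s_i)$. The sum has finitely many nonzero terms, and in each of them all but finitely many factors equal $1$. Parameters are assumed such that no denominator vanishes. *)

(* Defs.v *)
From HB Require Import structures.
From mathcomp Require Import all_boot all_order all_algebra complex.
From mathcomp Require Import all_classical all_reals all_analysis.

Set Implicit Arguments.
Unset Strict Implicit.
Unset Printing Implicit Defensive.

Import Order.TTheory GRing.Theory Num.Theory.
Import numFieldNormedType.Exports.

Local Open Scope classical_set_scope.
Local Open Scope ring_scope.

(* Columns, rows, parts and parameter sequences are all indexed from 0: column
   i : nat is the column i + 1 of Z_{>=1}, so that [y i] stands for y_{i+1}. *)

(* A signature with N parts is an N-tuple [lam] of naturals such that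
   [sorted geq lam]. [sig_pos lam i] is lam_i + N - i for 1-based i, that is,
   the 0-based column of the element lam_i + N + 1 - i of S(lam). *)
Definition sig_pos (N : nat) (lam : N.-tuple nat) (i : 'I_N) : nat :=
  (tnth lam i + (N - i.+1))%N.

Definition sig_columns (N : nat) (lam : N.-tuple nat) : seq nat :=
  codom (sig_pos lam).

Section VertexModel.
Variable R : realType.
Local Notation C := R[i].

Definition vertex_weight (i1 j1 i2 j2 : bool) (x y r s : C) : C :=
  match i1, j1, i2, j2 with
  | false, false, false, false => 1
  | true, true, true, true => (r ^- 2 * x - y) / (s ^- 2 * y - x)
  | true, false, true, false => (s ^- 2 * y - r ^- 2 * x) / (s ^- 2 * y - x)
  | false, true, false, true => (y - x) / (s ^- 2 * y - x)
  | true, false, false, true => x * (r ^- 2 - 1) / (s ^- 2 * y - x)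
  | false, true, true, false => y * (s ^- 2 - 1) / (s ^- 2 * y - x)
  | _, _, _, _ => 0
  end.

(* [c.1 i j] is the vertical edge of column i below row j (above the last row
   for j = M); [c.2 i j] is the horizontal edge of row j to the left of
   column i. *)
Definition config (M : nat) : Type :=
  ((nat -> 'I_M.+1 -> bool) * (nat -> 'I_M -> bool))%type.

Definition admissible (N M : nat) (lam : N.-tuple nat) : set (config M) :=
  [set c | [/\ forall i, c.1 i ord0 = (i < N)%N,
               forall i, c.1 i ord_max = (i \in sig_columns lam),
               forall j, c.2 0%N j = false &
               \forall i \near \oo, forall j, c.2 i j = false]].

Definition column_weight (M : nat) (w : 'I_M -> C) (y : nat -> C)
    (theta : 'I_M -> C) (s : nat -> C) (c : config M) (i : nat) : C :=
  \prod_(j < M) vertex_weight (c.1 i (widen_ord (leqnSn M) j)) (c.2 i j)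
                  (c.1 i (lift ord0 j)) (c.2 i.+1 j) (w j) (y i) (theta j) (s i).

(* The infinite product is the limit of its partial products. This makes the
   weight 0 when infinitely many vertices have weight 0, which a finitely
   supported product would not. *)
Definition config_weight (M : nat) (w : 'I_M -> C) (y : nat -> C)
    (theta : 'I_M -> C) (s : nat -> C) (c : config M) : C :=
  limn (fun n => (\prod_(i < n) column_weight w y theta s c i : C^o)).

Definition partition_function (N M : nat) (lam : N.-tuple nat)
    (w : 'I_M -> C) (y : nat -> C) (theta : 'I_M -> C) (s : nat -> C) : C :=
  \sum_(c \in @admissible N M lam) config_weight w y theta s c.

End VertexModel.

Section Contour.
Variable R : realType.
Local Notation C := R[i].

(* A 1-cycle made of finitely many C^1 arcs parametrized by [0, 1]. That the
   initial and the final points of the arcs agree as multisets says that the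
   arcs can be assembled into finitely many closed piecewise C^1 curves. The
   velocity is only asked to be the derivative inside ]0, 1[: with continuity
   on [0, 1] this also gives the one-sided derivatives at the endpoints. *)
Record contour := Contour {
  contour_size : nat;
  contour_arc : 'I_contour_size -> R -> C;
  contour_velocity : 'I_contour_size -> R -> C;
  contour_continuous : forall k,
    {within `[0, 1], continuous (fun t => complex.Re (contour_arc k t))} /\
    {within `[0, 1], continuous (fun t => complex.Im (contour_arc k t))};
  contour_velocity_continuous : forall k,
    {within `[0, 1], continuous (fun t => complex.Re (contour_velocity k t))} /\
    {within `[0, 1], continuous (fun t => complex.Im (contour_velocity k t))};
  contour_derive : forall k (t : R), 0 < t < 1 ->
    is_derive t 1 (fun u => complex.Re (contour_arc k u))
      (complex.Re (contour_velocity k t)) /\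
    is_derive t 1 (fun u => complex.Im (contour_arc k u))
      (complex.Im (contour_velocity k t));
  contour_closed : perm_eq (codom (fun k => contour_arc k 0))
                           (codom (fun k => contour_arc k 1))
}.

Definition complex_integral (f : R -> C) : C :=
  (\int[lebesgue_measure]_(t in `[0, 1]) complex.Re (f t) +i*
   \int[lebesgue_measure]_(t in `[0, 1]) complex.Im (f t))%C.

Definition contour_integral (g : contour) (f : C -> C) : C :=
  \sum_(k < contour_size g)
    complex_integral (fun t => f (contour_arc k t) * contour_velocity k t).

Definition twopii : C := (0 +i* (2 * pi))%C.

Definition on_contour (g : contour) (a : C) : Prop :=
  exists k : 'I_(contour_size g),
    exists2 t : R, 0 <= t <= 1 & contour_arc k t = a.

Definition winding (g : contour) (a : C) : C :=
  twopii^-1 * contour_integral g (fun z => (z - a)^-1).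

(* Winding number 1, rather than -1, encodes the positive orientation. *)
Definition surrounds (g : contour) (a : C) : Prop :=
  ~ on_contour g a /\ winding g a = 1.

Definition leaves_out (g : contour) (a : C) : Prop :=
  ~ on_contour g a /\ winding g a = 0.

Definition psi (k : nat) (x : C) (y s : nat -> C) : C :=
  y k * (s k ^- 2 - 1) / (x - s k ^- 2 * y k) *
  \prod_(j < k) ((x - y j) / (x - s j ^- 2 * y j)).

(* [m] is 0-based: [hfun g k m] is h_{k,m+1}. *)
Definition hfun (g : contour) (k m : nat) (M : nat) (w : 'I_M -> C)
    (y : nat -> C) (theta : 'I_M -> C) (s : nat -> C) : C :=
  twopii^-1 * contour_integral g (fun z =>
    psi k z y s / (y m - z) *
    \prod_(j < M) ((z - theta j ^- 2 * w j) / (z - w j))).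

End Contour.

(* Main.v *)
(* The vertex weights are free fermionic, so a vertex acts on the N x N minors
   of a matrix as a 2 x 2 block multiplying two adjacent rows. Sweeping the
   vertices of a row of the lattice from left to right therefore transports the
   minors of the contour functions h_{k,m} built from the rows below to those
   that also include the current row. This needs only that h satisfies the
   one-path recursion, with [travel] for the path occupying a horizontal edge;
   it is an identity of rational functions up to a term
   1 / ((z - w_j) (y_m - z)) * (product of eigenvalues), whose contour integral
   vanishes because all its poles are surrounded and it decays like z^-2.
   Before the first row, h_{k,m} is minus psi_k(y_m), which is zero for m < k.
   Hence only the initial state {1, ..., N} contributes, with a triangular
   determinant that, up to the sign (-1)^(N(N-1)/2) of reversing the columns of
   the signature, is the inverse of the prefactor. *)

Require Import Defs.
From HB Require Import structures.
From mathcomp Require Import all_boot all_order all_algebra complex.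
From mathcomp Require Import ring.
From mathcomp Require Import all_classical all_reals all_analysis.

Set Implicit Arguments.
Unset Strict Implicit.
Unset Printing Implicit Defensive.

Import Order.TTheory GRing.Theory Num.Theory.
Import numFieldNormedType.Exports.

Local Open Scope classical_set_scope.
Local Open Scope ring_scope.

(** * Integration along contours *)

Section ComplexPaths.
Variable R : realType.
Local Notation C := R[i].
Local Notation Re := complex.Re.
Local Notation Im := complex.Im.

Lemma complexReD (x y : C) : Re (x + y) = Re x + Re y.
Proof. by case: x y => [a b] [c d]. Qed.

Lemma complexImD (x y : C) : Im (x + y) = Im x + Im y.
Proof. by case: x y => [a b] [c d]. Qed.

Lemma complexReN (x : C) : Re (- x) = - Re x.
Proof. by case: x. Qed.

Lemma complexImN (x : C) : Im (- x) = - Im x.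
Proof. by case: x. Qed.

Lemma complexReM (x y : C) : Re (x * y) = Re x * Re y - Im x * Im y.
Proof. by case: x y => [a b] [c d]. Qed.

Lemma complexImM (x y : C) : Im (x * y) = Re x * Im y + Im x * Re y.
Proof. by case: x y => [a b] [c d]. Qed.

Lemma complexReV (x : C) : Re x^-1 = Re x / (Re x ^+ 2 + Im x ^+ 2).
Proof. by case: x. Qed.

Lemma complexImV (x : C) : Im x^-1 = - (Im x / (Re x ^+ 2 + Im x ^+ 2)).
Proof. by case: x => a b /=. Qed.

Lemma normsq_neq0 (x : C) : x != 0 -> Re x ^+ 2 + Im x ^+ 2 != 0.
Proof.
apply: contra_neq => /eqP; case: x => a b /=.
by rewrite paddr_eq0 ?sqr_ge0// !sqrf_eq0 => /andP[/eqP-> /eqP->].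
Qed.

Definition path_continuous (f : R -> C) :=
  {within `[0, 1], continuous (fun t => Re (f t))} /\
  {within `[0, 1], continuous (fun t => Im (f t))}.

Lemma path_continuous_cst (a : C) : path_continuous (fun=> a).
Proof. by split=> t; apply: cvg_cst. Qed.

Lemma path_continuousD (f g : R -> C) : path_continuous f -> path_continuous g ->
  path_continuous (fun t => f t + g t).
Proof.
move=> [/subspace_continuousP f1 /subspace_continuousP f2].
move=> [/subspace_continuousP g1 /subspace_continuousP g2].
split; apply/subspace_continuousP => t t01.
  rewrite (funext (fun t => complexReD (f t) (g t))).
  by apply: cvgD; [exact: f1|exact: g1].
rewrite (funext (fun t => complexImD (f t) (g t))).
  by apply: cvgD; [exact: f2|exact: g2].
Qed.

Lemma path_continuousM (f g : R -> C) : path_continuous f -> path_continuous g ->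
  path_continuous (fun t => f t * g t).
Proof.
move=> [/subspace_continuousP f1 /subspace_continuousP f2].
move=> [/subspace_continuousP g1 /subspace_continuousP g2].
split; apply/subspace_continuousP => t t01.
  rewrite (funext (fun t => complexReM (f t) (g t))).
  by apply: cvgB; apply: cvgM; (exact: f1 || exact: f2 || exact: g1 || exact: g2).
rewrite (funext (fun t => complexImM (f t) (g t))).
by apply: cvgD; apply: cvgM; (exact: f1 || exact: f2 || exact: g1 || exact: g2).
Qed.

Lemma path_continuousV (f : R -> C) : (forall t, 0 <= t <= 1 -> f t != 0) ->
  path_continuous f -> path_continuous (fun t => (f t)^-1).
Proof.
move=> f0 [/subspace_continuousP f1 /subspace_continuousP f2].
have f3 (t : R) : `[0%R, 1%R]%classic t ->
    (fun t => (Re (f t) ^+ 2 + Im (f t) ^+ 2)^-1 : R) @ within `[0%R, 1%R] (nbhs t) -->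
    ((Re (f t) ^+ 2 + Im (f t) ^+ 2)^-1 : R).
  move=> t01; apply: cvgV; first exact: normsq_neq0 (f0 _ _).
  by rewrite !expr2; apply: cvgD; apply: cvgM; (exact: f1 || exact: f2).
split; apply/subspace_continuousP => t t01.
  rewrite (funext (fun t => complexReV (f t))).
  by apply: cvgM; [exact: f1|exact: f3].
rewrite (funext (fun t => complexImV (f t))).
by apply: cvgN; apply: cvgM; [exact: f2|exact: f3].
Qed.

(* Componentwise, since [R[i]] carries no normed module structure over [R]. *)
Definition path_derive (t : R) (f : R -> C) (df : C) :=
  is_derive t 1 (fun u => Re (f u)) (Re df) /\ is_derive t 1 (fun u => Im (f u)) (Im df).

Lemma path_deriveM (t : R) (f g : R -> C) (df dg : C) :
  path_derive t f df -> path_derive t g dg ->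
  path_derive t (fun u => f u * g u) (f t * dg + g t * df).
Proof.
move=> [f1 f2] [g1 g2]; split.
  rewrite (_ : (fun u => _) =
    (fun u => Re (f u)) * (fun u => Re (g u)) - (fun u => Im (f u)) * (fun u => Im (g u))); last first.
    by apply/funext => u; rewrite complexReM.
  by apply: is_derive_eq; rewrite complexReD !complexReM /=; rewrite /GRing.scale /=; ring.
rewrite (_ : (fun u => _) =
  (fun u => Re (f u)) * (fun u => Im (g u)) + (fun u => Im (f u)) * (fun u => Re (g u))); last first.
  by apply/funext => u; rewrite complexImM.
by apply: is_derive_eq; rewrite complexImD !complexImM /=; rewrite /GRing.scale /=; ring.
Qed.

Lemma path_deriveB (t : R) (f : R -> C) (df a : C) :
  path_derive t f df -> path_derive t (fun u => f u - a) df.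
Proof.
move=> [f1 f2]; split.
  rewrite (_ : (fun u => _) = (fun u => Re (f u)) - cst (Re a)); last first.
    by apply/funext => u; rewrite complexReD complexReN.
  by apply: is_derive_eq; rewrite subr0.
rewrite (_ : (fun u => _) = (fun u => Im (f u)) - cst (Im a)); last first.
  by apply/funext => u; rewrite complexImD complexImN.
by apply: is_derive_eq; rewrite subr0.
Qed.

Lemma path_deriveV (t : R) (f : R -> C) (df : C) :
  f t != 0 -> path_derive t f df ->
  path_derive t (fun u => (f u)^-1) (- df * (f t)^-1 ^+ 2).
Proof.
move=> /normsq_neq0 ft0 [f1 f2].
(* [n] is the squared modulus of [f]: the components of 1 / f are those of the conjugate of [f]
   divided by [n], so real differentiation rules suffice. *)
pose n := (fun u => Re (f u)) ^+ 2 + (fun u => Im (f u)) ^+ 2.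
have nt0 : n t != 0 by [].
have n0 : is_derive t 1 n ((Re (f t) * Re df + Im (f t) * Im df) *+ 2).
  by apply: is_derive_eq; rewrite /GRing.scale /=; ring.
have n1 : is_derive t 1 (fun u => (n u)^-1) _ := is_deriveV nt0 n0.
split.
  rewrite (_ : (fun u => _) = (fun u => Re (f u)) * (fun u => (n u)^-1)); last first.
    by apply/funext => u; rewrite complexReV.
  apply: is_derive_eq.
  rewrite expr2 !complexReM complexReN /= !complexImM complexImN /=.
  rewrite complexReV complexImV /GRing.scale /=.
  move: ft0 nt0; rewrite /n !fctE /=; move: (Re (f t)) (Im (f t)) => a b ab _.
  by field.
rewrite (_ : (fun u => _) = - ((fun u => Im (f u)) * (fun u => (n u)^-1))); last first.
  by apply/funext => u; rewrite complexImV.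
apply: is_derive_eq.
rewrite expr2 !complexImM complexImN /= !complexReM complexReN /=.
  rewrite complexReV complexImV /GRing.scale /=.
move: ft0 nt0; rewrite /n !fctE /=; move: (Re (f t)) (Im (f t)) => a b ab _.
by field.
Qed.

End ComplexPaths.

(** * Integrals over arcs, and over the cycle they form *)

Section ContourIntegral.
Variable R : realType.
Local Notation C := R[i].
Local Notation Re := complex.Re.
Local Notation Im := complex.Im.

Lemma path_continuous_integrable (f : R -> C) : path_continuous f ->
  lebesgue_measure.-integrable `[0%R, 1%R] (EFin \o (fun t => Re (f t))) /\
  lebesgue_measure.-integrable `[0%R, 1%R] (EFin \o (fun t => Im (f t))).
Proof.
by move=> [f1 f2]; split; apply: continuous_compact_integrable => //; exact: segment_compact.
Qed.

Lemma complex_integralD (f g : R -> C) : path_continuous f -> path_continuous g ->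
  complex_integral (fun t => f t + g t) = complex_integral f + complex_integral g.
Proof.
move=> /path_continuous_integrable[f1 f2] /path_continuous_integrable[g1 g2].
rewrite /complex_integral (funext (fun t => complexReD (f t) (g t)))
  (funext (fun t => complexImD (f t) (g t))).
by rewrite !RintegralD.
Qed.

Lemma complex_integralZ (a : C) (f : R -> C) : path_continuous f ->
  complex_integral (fun t => a * f t) = a * complex_integral f.
Proof.
move=> /path_continuous_integrable[f1 f2].
have mI : measurable `[0%R, 1%R : R] by [].
have If r (h : R -> R) : lebesgue_measure.-integrable `[0%R, 1%R] (EFin \o h) ->
    lebesgue_measure.-integrable `[0%R, 1%R] (EFin \o (fun t => r * h t)).
  by move=> ih; apply: (integrableZl _ r ih).
rewrite /complex_integral (funext (fun t => complexReM a (f t)))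
  (funext (fun t => complexImM a (f t))).
rewrite RintegralB ?RintegralD//; try exact: If.
by rewrite !RintegralZl//; case: a.
Qed.

(** The real fundamental theorem of calculus, applied to each component. *)
Lemma complex_integral_derive (f df : R -> C) : path_continuous f -> path_continuous df ->
  (forall t, 0 < t < 1 -> path_derive t f (df t)) ->
  complex_integral df = f 1 - f 0.
Proof.
have ftc (g dg : R -> R) : {within `[0, 1], continuous g} ->
    {within `[0, 1], continuous dg} ->
    (forall t : R, 0 < t < 1 -> is_derive t 1 g (dg t)) ->
    \int[lebesgue_measure]_(t in `[0, 1]) dg t = g 1 - g 0.
  move=> cg cdg gdg; rewrite /Rintegral (@continuous_FTC2 _ dg g)//.
    have /(continuous_within_itvP _ (ltr01 : (0 : R) < 1))[_ g0 g1] := cg.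
    by split => // t; rewrite in_itv/= => /gdg [].
  by move=> t; rewrite in_itv/= derive1E => /gdg [].
move=> [f1 f2] [d1 d2] fdf; rewrite /complex_integral.
rewrite (ftc _ _ f1 d1 (fun t t01 => (fdf t t01).1)).
rewrite (ftc _ _ f2 d2 (fun t t01 => (fdf t t01).2)).
by move: (f 1) (f 0) => [a b] [c d].
Qed.

Variable gam : contour R.

Definition contour_continuous_fun (f : C -> C) :=
  forall k : 'I_(contour_size gam), path_continuous (fun t => f (contour_arc k t)).

Lemma contour_continuous_cst (a : C) : contour_continuous_fun (fun=> a).
Proof. by move=> k; apply: path_continuous_cst. Qed.

Lemma contour_continuous_id : contour_continuous_fun id.
Proof. by move=> k; apply: contour_continuous. Qed.

Lemma contour_continuousD (f g : C -> C) : contour_continuous_fun f ->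
  contour_continuous_fun g -> contour_continuous_fun (fun z => f z + g z).
Proof. by move=> cf cg k; apply: path_continuousD. Qed.

Lemma contour_continuousM (f g : C -> C) : contour_continuous_fun f ->
  contour_continuous_fun g -> contour_continuous_fun (fun z => f z * g z).
Proof. by move=> cf cg k; apply: path_continuousM. Qed.

Lemma contour_continuous_inv_sub (a : C) : ~ on_contour gam a ->
  contour_continuous_fun (fun z => (z - a)^-1).
Proof.
move=> na k; apply: path_continuousV.
  by move=> t t01; apply/eqP => /subr0_eq ta; apply: na; exists k; exists t.
exact: path_continuousD (contour_continuous k) (path_continuous_cst _).
Qed.

Lemma contour_continuous_prod (I : Type) (r : seq I) (P : pred I) (F : I -> C -> C) :
  (forall i, P i -> contour_continuous_fun (F i)) ->
  contour_continuous_fun (fun z => \prod_(i <- r | P i) F i z).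
Proof.
move=> cF; elim: r => [|i r IHr].
  rewrite [X in contour_continuous_fun X](_ : _ = fun=> 1).
    exact: contour_continuous_cst.
  by apply/funext => z; rewrite big_nil.
have [Pi|nPi] := boolP (P i).
  rewrite [X in contour_continuous_fun X](_ : _ =
    fun z => F i z * \prod_(j <- r | P j) F j z).
    by apply: contour_continuousM => //; exact: cF.
  by apply/funext => z; rewrite big_cons Pi.
rewrite [X in contour_continuous_fun X](_ : _ =
  fun z => \prod_(j <- r | P j) F j z) //.
by apply/funext => z; rewrite big_cons (negbTE nPi).
Qed.

(** With this factor [winding gam a] is [cint] of 1 / (z - a), and [hfun] is [cint] of its
    integrand. *)
Definition cint (f : C -> C) : C := (twopii R)^-1 * contour_integral gam f.

Lemma eq_cint (f g : C -> C) : (forall z, on_contour gam z -> f z = g z) ->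
  cint f = cint g.
Proof.
move=> fg; rewrite /cint /contour_integral; congr (_ * _); apply: eq_bigr => k _.
rewrite /complex_integral; congr (_ +i* _)%C; apply: eq_Rintegral => t;
  rewrite inE/= in_itv/= => t01; rewrite fg//; exists k; exists t => //.
Qed.

Lemma cintD (f g : C -> C) : contour_continuous_fun f -> contour_continuous_fun g ->
  cint (fun z => f z + g z) = cint f + cint g.
Proof.
move=> cf cg; rewrite /cint -mulrDr; congr (_ * _).
rewrite /contour_integral -big_split; apply: eq_bigr => k _ /=.
rewrite (funext (fun t => mulrDl (f (contour_arc k t)) (g (contour_arc k t))
  (contour_velocity k t))).
by rewrite complex_integralD//; apply: path_continuousM => //; exact: contour_velocity_continuous.
Qed.

Lemma cintZ (a : C) (f : C -> C) : contour_continuous_fun f ->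
  cint (fun z => a * f z) = a * cint f.
Proof.
move=> cf; rewrite /cint mulrCA; congr (_ * _).
rewrite /contour_integral big_distrr; apply: eq_bigr => k _ /=.
rewrite -(funext (fun t => mulrA a (f (contour_arc k t)) (contour_velocity k t))).
by rewrite complex_integralZ//; apply: path_continuousM => //; exact: contour_velocity_continuous.
Qed.

(** A power of order at least 2 has a single-valued primitive, so each arc contributes a difference
    of endpoint values; these cancel in total because the cycle is closed. *)
Lemma cint_invXn (a : C) (n : nat) : ~ on_contour gam a ->
  cint (fun z => (z - a)^-1 ^+ n.+2) = 0.
Proof.
move=> na; pose F (z : C) := (z - a)^-1 ^+ n.+1.
pose dF (z : C) := - n.+1%:R * (z - a)^-1 ^+ n.+2.
have cX m : contour_continuous_fun (fun z => (z - a)^-1 ^+ m).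
  elim: m => [|m IHm]; first exact: contour_continuous_cst.
  rewrite (funext (fun z => exprS (z - a)^-1 m)).
  by apply: contour_continuousM => //; exact: contour_continuous_inv_sub.
have n0 : - n.+1%:R != 0 :> C by rewrite oppr_eq0 pnatr_eq0.
apply: (mulfI n0); rewrite mulr0 -cintZ// /cint.
suff -> : contour_integral gam dF = 0 by rewrite mulr0.
have -> : contour_integral gam dF =
    \sum_(k < contour_size gam) (F (contour_arc k 1) - F (contour_arc k 0)).
  apply: eq_bigr => k _.
  apply: (complex_integral_derive (f := fun t => F (contour_arc k t))); first exact: cX.
    apply: path_continuousM; last exact: contour_velocity_continuous.
    by apply: path_continuousM; [exact: path_continuous_cst|exact: cX].
  move=> t t01; have Dk : path_derive t (contour_arc k) (contour_velocity k t).
    exact: contour_derive.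
  have ak : contour_arc k t - a != 0.
    apply/eqP => /subr0_eq ta; apply: na; exists k; exists t => //.
    by case/andP: t01 => ? ?; rewrite !ltW.
  have DV := path_deriveV ak (path_deriveB a Dk).
  have : forall m, path_derive t (fun u => (contour_arc k u - a)^-1 ^+ m.+1)
    (- m.+1%:R * (contour_arc k t - a)^-1 ^+ m.+2 * contour_velocity k t).
    elim=> [|m IHm].
      by move: DV; rewrite mulN1r mulNr [in X in X -> _]mulNr mulrC.
    rewrite (funext (fun u => exprS (contour_arc k u - a)^-1 m.+1)).
    have := path_deriveM DV IHm; congr path_derive.
    by rewrite -natr1 [in RHS]exprS [in LHS]exprS !exprS; ring.
  exact.
rewrite sumrB; apply/eqP; rewrite subr_eq0; apply/eqP.
(* Closedness compares endpoints only as multisets, so both sums are rewritten over the lists of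
   endpoints. *)
have perm := contour_closed gam.
have sE t : \sum_(k < contour_size gam) F (contour_arc k t) =
    \sum_(z <- codom (fun k : 'I_(contour_size gam) => contour_arc k t)) F z.
  by rewrite big_map big_enum.
by rewrite !sE; apply: perm_big; rewrite perm_sym.
Qed.

End ContourIntegral.

(** * Residues *)

Section Residues.
Variables (R : realType) (gam : contour R).
Local Notation C := R[i].
Local Notation cint := (cint gam).
Local Notation cc := (contour_continuous_fun gam).

Lemma on_contour_sub_neq0 (a z : C) : ~ on_contour gam a -> on_contour gam z -> z - a != 0.
Proof. by move=> na az; apply/eqP => /subr0_eq za; apply: na; rewrite -za. Qed.

Lemma contour_continuous_prod_inv (r : seq C) : {in r, forall a, ~ on_contour gam a} ->
  cc (fun z => \prod_(a <- r) (z - a)^-1).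
Proof.
move=> nr; rewrite [X in cc X](_ : _ = fun z => \prod_(a <- r | a \in r) (z - a)^-1).
  by apply: contour_continuous_prod => a /nr; exact: contour_continuous_inv_sub.
by apply/funext => z; rewrite big_seq_cond; under eq_bigl do rewrite andbT.
Qed.

(* Poles with the same winding number [c] cancel: distinct ones are separated
   by partial fractions, and [(z - a) ^- n] has a primitive for [n >= 2]. *)
Lemma cint_prod_inv (c : C) (r : seq C) : r != [::] ->
  {in r, forall a, ~ on_contour gam a /\ winding gam a = c} ->
  cint (fun z => \prod_(a <- r) (z - a)^-1) = c *+ (size r == 1)%N.
Proof.
have [n] := ubnP (size r); elim: n r => // n IHn [//|a r] /= sr _ rP.
have [/allP ra|/allPn[b br ba]] := boolP (all (pred1 a) r).
  have rE : r = nseq (size r) a by apply/all_pred1P/allP.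
  have [na wa] := rP a (mem_head _ _).
  rewrite rE; case: (size r) => [|k] /=.
    by rewrite -wa; apply: (@eq_cint _ _ _ (fun z => (z - a)^-1)) => z _; rewrite big_seq1.
  rewrite -[RHS](cint_invXn k na); apply: eq_cint => z _.
  by rewrite -[_ :: _]/(nseq k.+2 a) big_nseq iter_mulr_1.
pose r' := rem b r.
have prr : perm_eq (a :: r) (a :: b :: r') by rewrite perm_cons; exact: perm_to_rem.
have srr : size r = (size r').+1 by have /perm_size[] := prr.
have nP x : x \in [:: a, b & r'] -> ~ on_contour gam x /\ winding gam x = c.
  by rewrite -(perm_mem prr); exact: rP.
have aP : {in a :: r', forall x, ~ on_contour gam x /\ winding gam x = c}.
  by move=> x; rewrite inE => xr; apply: nP; rewrite !inE; case/orP: xr => ->; rewrite ?orbT.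
have bP : {in b :: r', forall x, ~ on_contour gam x /\ winding gam x = c}.
  by move=> x; rewrite inE => xr; apply: nP; rewrite !inE; case/orP: xr => ->; rewrite ?orbT.
have ab : a - b != 0 by rewrite subr_eq0 eq_sym.
have ca := contour_continuous_prod_inv (fun x xr => (aP x xr).1).
have cb := contour_continuous_prod_inv (fun x xr => (bP x xr).1).
rewrite (_ : cint _ = cint (fun z => (a - b)^-1 * \prod_(x <- a :: r') (z - x)^-1 +
   - (a - b)^-1 * \prod_(x <- b :: r') (z - x)^-1)); last first.
  apply: eq_cint => z gz; rewrite (perm_big _ prr) /= !big_cons.
  have [na _] := aP a (mem_head _ _); have [nb _] := bP b (mem_head _ _).
  have za := on_contour_sub_neq0 na gz; have zb := on_contour_sub_neq0 nb gz.
  by field; rewrite ab za zb.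
rewrite cintD ?cintZ//; try by apply: contour_continuousM => //; exact: contour_continuous_cst.
(* Both lists are one pole shorter and have equal length, so by induction their integrals coincide
   and the opposite coefficients cancel them. *)
rewrite !IHn//= -?srr//.
by rewrite srr eqSS mulNr subrr.
Qed.

Lemma contour_continuous_prod_1Ddiv (I : Type) (l : seq I) (d b : I -> C) :
  (forall i, ~ on_contour gam (b i)) ->
  cc (fun z => \prod_(i <- l) (1 + d i / (z - b i))).
Proof.
move=> nb; apply: contour_continuous_prod => i _.
apply: contour_continuousD; first exact: contour_continuous_cst.
apply: contour_continuousM; first exact: contour_continuous_cst.
exact: contour_continuous_inv_sub.
Qed.

(** Expanding a factor 1 + d / (z - b) either leaves the list of poles alone or adds [b] to it.
    Every resulting term keeps at least two poles, all of winding number [c], and so integrates to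
    0. *)
Lemma cint_prod_inv_1Ddiv (c : C) (r : seq C) (I : Type) (l : seq I) (d b : I -> C) :
  (1 < size r)%N ->
  {in r, forall a, ~ on_contour gam a /\ winding gam a = c} ->
  (forall i, ~ on_contour gam (b i) /\ winding gam (b i) = c) ->
  cint (fun z => \prod_(a <- r) (z - a)^-1 * \prod_(i <- l) (1 + d i / (z - b i))) = 0.
Proof.
move=> + + bP; elim: l r => [|i l IHl] r sr rP.
  rewrite (_ : cint _ = cint (fun z => \prod_(a <- r) (z - a)^-1)).
    by rewrite (cint_prod_inv _ rP) ?gtn_eqF//; case: r sr {rP}.
  by apply: eq_cint => z _; rewrite big_nil mulr1.
have rP' : {in b i :: r, forall a, ~ on_contour gam a /\ winding gam a = c}.
  by move=> a; rewrite inE => /predU1P[->//|]; exact: rP.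
pose P r' z := \prod_(a <- r') (z - a)^-1 * \prod_(i <- l) (1 + d i / (z - b i)).
rewrite (_ : cint _ = cint (fun z => P r z + d i * P (b i :: r) z)); last first.
  by apply: eq_cint => z _; rewrite /P !big_cons; ring.
have cP r' : {in r', forall a, ~ on_contour gam a /\ winding gam a = c} -> cc (P r').
  move=> r'P; apply: contour_continuousM.
    by apply: contour_continuous_prod_inv => a /r'P[].
  by apply: contour_continuous_prod_1Ddiv => j; case: (bP j).
rewrite cintD ?cintZ//; try exact: cP.
  by rewrite !IHl ?mulr0 ?addr0//= ltnW.
by apply: contour_continuousM; [exact: contour_continuous_cst|exact: cP].
Qed.

Lemma surrounds_leaves_out_neq (a b : C) : surrounds gam a -> leaves_out gam b -> a - b != 0.
Proof.
move=> [_ wa] [_ wb]; apply/eqP => /subr0_eq ab.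
by have /eqP := oner_neq0 C; rewrite -wa ab wb.
Qed.

(** Cauchy's formula with [y] as the only surrounded pole. Partial fractions split off each outer
    pole; what remains with outer poles only integrates to 0, by [cint_prod_inv] with winding number
    0. *)
Lemma cint_residue (y : C) (r : seq C) (I : Type) (l : seq I) (d b : I -> C) :
  surrounds gam y -> {in r, forall a, leaves_out gam a} ->
  (forall i, leaves_out gam (b i)) ->
  cint (fun z => (z - y)^-1 *
    (\prod_(a <- r) (z - a)^-1 * \prod_(i <- l) (1 + d i / (z - b i)))) =
  \prod_(a <- r) (y - a)^-1 * \prod_(i <- l) (1 + d i / (y - b i)).
Proof.
move=> ySur + bP; have [ny wy] := ySur.
elim: l r => [|i l IHl] r rP.
  rewrite big_nil mulr1 (_ : cint _ =
    cint (fun z => (z - y)^-1 * \prod_(a <- r) (z - a)^-1)); last first.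
    by apply: eq_cint => z _; rewrite big_nil mulr1.
  elim: r rP => [|a r IHr] arP.
    rewrite big_nil -[RHS]wy; apply: (@eq_cint _ _ _ (fun z => (z - y)^-1)) => z _.
    by rewrite big_nil mulr1.
  have aP := arP a (mem_head _ _).
  have rP : {in r, forall a, leaves_out gam a} by move=> x xr; apply: arP; rewrite inE xr orbT.
  have ya := surrounds_leaves_out_neq ySur aP.
  have cr := contour_continuous_prod_inv (fun x xr => (arP x xr).1).
  have cy : cc (fun z => (z - y)^-1 * \prod_(a <- r) (z - a)^-1).
    apply: contour_continuousM; first exact: contour_continuous_inv_sub.
    exact: contour_continuous_prod_inv (fun x xr => (rP x xr).1).
  rewrite (_ : cint _ = cint (fun z =>
     (y - a)^-1 * ((z - y)^-1 * \prod_(x <- r) (z - x)^-1) +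
     - (y - a)^-1 * \prod_(x <- a :: r) (z - x)^-1)); last first.
    apply: eq_cint => z gz; rewrite !big_cons.
    have zy := on_contour_sub_neq0 ny gz; have za := on_contour_sub_neq0 aP.1 gz.
    by field; rewrite ya za zy.
  rewrite cintD ?cintZ//; try by apply: contour_continuousM => //; exact: contour_continuous_cst.
  by rewrite IHr// (cint_prod_inv _ arP)// mul0rn mulr0 addr0 big_cons.
have rP' : {in b i :: r, forall a, leaves_out gam a}.
  by move=> a; rewrite inE => /predU1P[->//|]; exact: rP.
pose P r' z := (z - y)^-1 * (\prod_(a <- r') (z - a)^-1 * \prod_(i <- l) (1 + d i / (z - b i))).
rewrite (_ : cint _ = cint (fun z => P r z + d i * P (b i :: r) z)); last first.
  by apply: eq_cint => z _; rewrite /P !big_cons; ring.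
have cP r' : {in r', forall a, leaves_out gam a} -> cc (P r').
  move=> r'P; apply: contour_continuousM; first exact: contour_continuous_inv_sub.
  apply: contour_continuousM.
    by apply: contour_continuous_prod_inv => a /r'P[].
  by apply: contour_continuous_prod_1Ddiv => j; case: (bP j).
rewrite cintD ?cintZ//; try exact: cP.
  by rewrite !IHl// !big_cons; ring.
by apply: contour_continuousM; [exact: contour_continuous_cst|exact: cP].
Qed.

End Residues.

(** * The contour functions as one-path amplitudes *)

(** Here [f] and [g] stand for the Blaschke products at [z] and [w], and [S], [T] for the inverse
    squares of [s] and [theta]. The term subtracted on the left is the polar part of psi times
    eigenvalue at z = w; the coefficients on the right are W(0,1;1,0) and W(1,0;1,0). *)
Lemma row_psi_identity (F : fieldType) (f g S T y w z : F) :
  z - w != 0 -> z - S * y != 0 -> S * y - w != 0 ->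
  y * (S - 1) / (z - S * y) * f * ((z - T * w) / (z - w)) +
    - (w * (1 - T) * (y * (S - 1) / (w - S * y) * g)) * (z - w)^-1 =
  y * (S - 1) / (S * y - w) * (w * (1 - T) * (z - w)^-1 * (g - f)) +
    (S * y - T * w) / (S * y - w) * (y * (S - 1) / (z - S * y) * f).
Proof.
move=> zw zs sw; have ws : w - S * y != 0 by rewrite -oppr_eq0 opprB.
by field; rewrite ws sw zs zw.
Qed.

(** The recursion of [travel] in the column, with coefficients W(0,1;0,1) and W(1,0;0,1). It holds
    pointwise in [z], without a remainder. *)
Lemma row_travel_identity (F : fieldType) (f g S T y w z : F) :
  z - w != 0 -> z - S * y != 0 -> S * y - w != 0 ->
  w * (1 - T) * (z - w)^-1 * (g * ((w - y) / (w - S * y)) - f * ((z - y) / (z - S * y))) =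
  (y - w) / (S * y - w) * (w * (1 - T) * (z - w)^-1 * (g - f)) +
    w * (T - 1) / (S * y - w) * (y * (S - 1) / (z - S * y) * f).
Proof.
move=> zw zs sw; have ws : w - S * y != 0 by rewrite -oppr_eq0 opprB.
by field; rewrite ws sw zs zw.
Qed.

Section ContourFunctions.
Variables (R : realType) (gam : contour R) (M : nat).
Local Notation C := R[i].
Local Notation cint := (cint gam).
Local Notation cc := (contour_continuous_fun gam).
Variables (w theta : 'I_M -> C) (y s : nat -> C).
Hypothesis weight_den : forall i j, s i ^- 2 * y i - w j != 0.
Hypothesis gam_y : forall i, surrounds gam (y i).
Hypothesis gam_w : forall j, surrounds gam (w j).
Hypothesis gam_sy : forall i, leaves_out gam (s i ^- 2 * y i).

(** Crossing row [j] multiplies psi_k(z) by this factor, up to a multiple of 1 / (z - w_j) with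
    coefficient independent of [z]. *)
Definition row_eigenvalue (j : 'I_M) (z : C) : C :=
  (z - theta j ^- 2 * w j) / (z - w j).

Definition rows_eigenvalue (n : nat) (z : C) : C :=
  \prod_(j < M | (j < n)%N) row_eigenvalue j z.

Definition hfun_rows (n k m : nat) : C :=
  cint (fun z => psi k z y s * ((y m - z)^-1 * rows_eigenvalue n z)).

Definition blaschke (k : nat) (z : C) : C :=
  \prod_(i < k) ((z - y i) / (z - s i ^- 2 * y i)).

(* The closed form of the solution [u] of [u 0 = 0] and
   [u k.+1 = W(0,1;0,1) u k + W(1,0;0,1) psi k]. *)
Definition travel (j : 'I_M) (k : nat) (z : C) : C :=
  w j * (1 - theta j ^- 2) * (z - w j)^-1 * (blaschke k (w j) - blaschke k z).

(** The amplitude of a path on the horizontal edge of row [j] entering column [k], given the rows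
    below [j]. *)
Definition travel_rows (j : 'I_M) (k m : nat) : C :=
  cint (fun z => travel j k z * ((y m - z)^-1 * rows_eigenvalue j z)).

Local Notation W j k a h b h' :=
  (vertex_weight a h b h' (w j) (y k) (theta j) (s k)).

Lemma psiE (k : nat) (z : C) :
  psi k z y s = y k * (s k ^- 2 - 1) / (z - s k ^- 2 * y k) * blaschke k z.
Proof. by []. Qed.

Lemma contour_continuous_ratio (a b : C) : ~ on_contour gam b ->
  cc (fun z => (z - a) / (z - b)).
Proof.
move=> nb; apply: contour_continuousM; last exact: contour_continuous_inv_sub.
by apply: contour_continuousD; [exact: contour_continuous_id|exact: contour_continuous_cst].
Qed.

Lemma contour_continuous_rows (n m : nat) : cc (fun z => (y m - z)^-1 * rows_eigenvalue n z).
Proof.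
apply: contour_continuousM.
  rewrite [X in cc X](_ : _ = fun z => -1 * (z - y m)^-1).
    by apply: contour_continuousM; [exact: contour_continuous_cst|
      apply: contour_continuous_inv_sub; case: (gam_y m)].
  by apply/funext => z; rewrite mulN1r -invrN opprB.
by apply: contour_continuous_prod => j _; apply: contour_continuous_ratio; case: (gam_w j).
Qed.

Lemma contour_continuous_blaschke (k : nat) : cc (blaschke k).
Proof.
by apply: contour_continuous_prod => i _; apply: contour_continuous_ratio; case: (gam_sy i).
Qed.

Lemma contour_continuous_psi (k : nat) : cc (fun z => psi k z y s).
Proof.
apply: contour_continuousM; last exact: contour_continuous_blaschke.
apply: contour_continuousM; first exact: contour_continuous_cst.
by apply: contour_continuous_inv_sub; case: (gam_sy k).
Qed.

Lemma contour_continuous_travel (j : 'I_M) (k : nat) : cc (travel j k).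
Proof.
apply: contour_continuousM.
  apply: contour_continuousM; first exact: contour_continuous_cst.
  by apply: contour_continuous_inv_sub; case: (gam_w j).
apply: contour_continuousD; first exact: contour_continuous_cst.
rewrite [X in cc X](_ : _ = fun z => -1 * blaschke k z).
  by apply: contour_continuousM; [exact: contour_continuous_cst|
    exact: contour_continuous_blaschke].
by apply/funext => z; rewrite mulN1r.
Qed.

Lemma ratioE (a b z : C) : z - b != 0 -> (z - a) / (z - b) = 1 + (b - a) / (z - b).
Proof. by move=> zb; field. Qed.

Lemma surrounds_sub_sy_neq0 (i k : nat) : y i - s k ^- 2 * y k != 0.
Proof. exact: surrounds_leaves_out_neq (gam_y i) (gam_sy k). Qed.

(** Without rows the only surrounded pole is y_m; the sign comes from the denominator y_m - z. *)
Lemma hfun_rows0 (k m : nat) : hfun_rows 0 k m = - psi k (y m) y s.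
Proof.
rewrite /hfun_rows.
(* Each Blaschke factor is put in the form 1 + d / (z - b) that [cint_residue] expects. *)
pose a := s k ^- 2 * y k; pose f z := (z - y m)^-1 * (\prod_(b <- [:: a]) (z - b)^-1 *
  \prod_(i <- index_enum 'I_k) (1 + (s i ^- 2 * y i - y i) / (z - s i ^- 2 * y i))).
have cf : cc f.
  apply: contour_continuousM; first by apply: contour_continuous_inv_sub; case: (gam_y m).
  apply: contour_continuousM.
    by apply: contour_continuous_prod_inv => b; rewrite inE => /eqP ->; case: (gam_sy k).
  by apply: contour_continuous_prod_1Ddiv => i; case: (gam_sy i).
rewrite (_ : cint _ = cint (fun z => - (y k * (s k ^- 2 - 1)) * f z)).
  rewrite cintZ// (cint_residue _ _ (gam_y m))//; last first.
    move=> b; rewrite inE => /eqP ->. exact: gam_sy.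
  rewrite psiE big_seq1 /blaschke.
  under [in RHS]eq_bigr do rewrite (ratioE _ (surrounds_sub_sy_neq0 _ _)).
  by rewrite mulrA !mulNr.
apply: eq_cint => z gz; rewrite /f psiE big_seq1 /blaschke.
have -> : rows_eigenvalue 0 z = 1 by exact: big_pred0.
rewrite mulr1.
under [in LHS]eq_bigr do rewrite (ratioE _ (on_contour_sub_neq0 (gam_sy _).1 gz)).
by rewrite -[y m - z]opprB invrN; ring.
Qed.

Lemma rows_eigenvalueS (j : 'I_M) (z : C) :
  rows_eigenvalue j.+1 z = row_eigenvalue j z * rows_eigenvalue j z.
Proof.
rewrite /rows_eigenvalue (bigD1 j)//=; congr (_ * _); apply: eq_bigl => i.
by rewrite ltnS ltn_neqAle andbC.
Qed.

(** The two explicit poles and those of the eigenvalues are all surrounded, so [cint_prod_inv_1Ddiv]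
    applies with winding number 1. *)
Lemma cint_rows_eq0 (j : 'I_M) (m : nat) :
  cint (fun z => (z - w j)^-1 * ((y m - z)^-1 * rows_eigenvalue j z)) = 0.
Proof.
pose l := [seq i : 'I_M <- index_enum 'I_M | (i < j)%N].
pose f z := \prod_(a <- [:: w j; y m]) (z - a)^-1 *
  \prod_(i <- l) (1 + (w i - theta i ^- 2 * w i) / (z - w i)).
have cf : cc f.
  apply: contour_continuousM; last first.
    by apply: contour_continuous_prod_1Ddiv => i; case: (gam_w i).
  apply: contour_continuous_prod_inv => a; rewrite !inE => /orP[]/eqP->.
    by case: (gam_w j).
  by case: (gam_y m).
rewrite (_ : cint _ = cint (fun z => -1 * f z)).
  rewrite cintZ// (cint_prod_inv_1Ddiv (c := 1)) ?mulr0// => a.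
  by rewrite !inE => /orP[]/eqP->; [exact: gam_w|exact: gam_y].
apply: eq_cint => z gz; rewrite /f mulN1r big_cons big_seq1.
rewrite -[y m - z]opprB invrN mulNr mulrN mulrA big_filter.
congr (- (_ * _)); apply: eq_bigr => i _.
by rewrite /row_eigenvalue ratioE// (on_contour_sub_neq0 (gam_w i).1 gz).
Qed.

Lemma cint_linear (a b : C) (f g h : C -> C) : cc f -> cc g ->
  (forall z, on_contour gam z -> h z = a * f z + b * g z) ->
  cint h = a * cint f + b * cint g.
Proof.
move=> cf cg hE; rewrite (eq_cint hE) -!cintZ// cintD//; apply: contour_continuousM => //;
  exact: contour_continuous_cst.
Qed.

Lemma hfun_rowsS (j : 'I_M) (k m : nat) :
  hfun_rows j.+1 k m = W j k false true true false * travel_rows j k m +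
                       W j k true false true false * hfun_rows j k m.
Proof.
pose X z := (y m - z)^-1 * rows_eigenvalue j z.
have cX : cc X by exact: contour_continuous_rows.
have cu : cc (fun z => travel j k z * X z).
  by apply: contour_continuousM => //; exact: contour_continuous_travel.
have cpsi : cc (fun z => psi k z y s * X z).
  by apply: contour_continuousM => //; exact: contour_continuous_psi.
have cw : cc (fun z => (z - w j)^-1 * X z).
  by apply: contour_continuousM => //; apply: contour_continuous_inv_sub; case: (gam_w j).
(* A multiple of the vanishing integral is added, chosen so that the integrands agree pointwise by
   [row_psi_identity]. *)
rewrite -[LHS]addr0 -[X in _ + X](mulr0 (- (w j * (1 - theta j ^- 2) * psi k (w j) y s))).
rewrite -(cint_rows_eq0 j m) -[hfun_rows j.+1 k m]mul1r.
rewrite -(cint_linear (h := fun z => 1 * (psi k z y s * ((y m - z)^-1 * rows_eigenvalue j.+1 z)) +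
    - (w j * (1 - theta j ^- 2) * psi k (w j) y s) * ((z - w j)^-1 * X z)))//; last first.
  by apply: contour_continuousM; [exact: contour_continuous_psi|exact: contour_continuous_rows].
apply: cint_linear cu cpsi _ => z gz.
rewrite mul1r [LHS](_ : _ = (psi k z y s * row_eigenvalue j z +
  - (w j * (1 - theta j ^- 2) * psi k (w j) y s) * (z - w j)^-1) * X z); last first.
  by rewrite rows_eigenvalueS /X; ring.
rewrite [X in _ = _ + X]mulrA [X in _ = X + _]mulrA -mulrDl; congr (_ * _).
exact: row_psi_identity (on_contour_sub_neq0 (gam_w j).1 gz)
  (on_contour_sub_neq0 (gam_sy k).1 gz) (weight_den k j).
Qed.

(** The two empty Blaschke products cancel. This is the boundary condition that no path enters from
    the left. *)
Lemma travel_rows0 (j : 'I_M) (m : nat) : travel_rows j 0 m = 0.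
Proof.
rewrite /travel_rows (_ : cint _ = cint (fun z => 0 * 0)).
  by rewrite cintZ ?mul0r//; exact: contour_continuous_cst.
by apply: eq_cint => z _; rewrite /travel /blaschke !big_ord0 subrr mulr0 !mul0r.
Qed.

Lemma travel_rowsS (j : 'I_M) (k m : nat) :
  travel_rows j k.+1 m = W j k false true false true * travel_rows j k m +
                         W j k true false false true * hfun_rows j k m.
Proof.
pose X z := (y m - z)^-1 * rows_eigenvalue j z.
have cX : cc X by exact: contour_continuous_rows.
have cu : cc (fun z => travel j k z * X z).
  by apply: contour_continuousM => //; exact: contour_continuous_travel.
have cpsi : cc (fun z => psi k z y s * X z).
  by apply: contour_continuousM => //; exact: contour_continuous_psi.
apply: cint_linear cu cpsi _ => z gz.
rewrite -/(X z) [X in _ = _ + X]mulrA [X in _ = X + _]mulrA -mulrDl; congr (_ * _).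
rewrite /travel /blaschke !big_ord_recr.
exact: row_travel_identity (on_contour_sub_neq0 (gam_w j).1 gz)
  (on_contour_sub_neq0 (gam_sy k).1 gz) (weight_den k j).
Qed.

End ContourFunctions.

(** * Free fermionic vertices *)

Section ListDet.
Variables (F : comNzRingType) (N : nat).
Implicit Types (l r : seq 'rV[F]_N) (u v : 'rV[F]_N).

(** Lists of rows let [mask] select the occupied columns. The value 0 at lengths other than [N]
    discards the states that do not have [N] paths. *)
Definition seq_det l : F :=
  if size l == N then \det (\matrix_(i < N) nth 0 l i) else 0.

Lemma seq_det_linear a b u v l r :
  seq_det (l ++ (a *: u + b *: v) :: r) =
  a * seq_det (l ++ u :: r) + b * seq_det (l ++ v :: r).
Proof.
rewrite /seq_det !size_cat /=; case: eqP => [sN|_]; last by rewrite !mulr0 addr0.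
have lN : (size l < N)%N by rewrite -[ltnRHS]sN addnS ltnS leq_addr.
apply: (determinant_multilinear (i0 := Ordinal lN)).
- by apply/rowP => j; rewrite !mxE /= !nth_cat ltnn subnn /= !mxE.
- apply/matrixP => i j; rewrite !mxE /= !nth_cat; case: ltngtP => // [il|il].
    by rewrite -(subnSK il).
  by case/eqP: (neq_lift (Ordinal lN) i); apply: val_inj.
- apply/matrixP => i j; rewrite !mxE /= !nth_cat; case: ltngtP => // [il|il].
    by rewrite -(subnSK il).
  by case/eqP: (neq_lift (Ordinal lN) i); apply: val_inj.
Qed.

Lemma seq_det_alternate u l r : seq_det (l ++ [:: u, u & r]) = 0.
Proof.
rewrite /seq_det size_cat /=; case: eqP => // sN.
have lN : (size l < N)%N by rewrite -[ltnRHS]sN addnS ltnS leq_addr.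
have lN' : ((size l).+1 < N)%N by rewrite -[ltnRHS]sN !addnS !ltnS leq_addr.
apply: (@determinant_alternate _ _ _ (Ordinal lN) (Ordinal lN')).
  by rewrite -val_eqE /= neq_ltn leqnn.
by move=> j; rewrite !mxE /= !nth_cat ltnn ltnNge leqnSn /= subnn subSnn.
Qed.

Lemma seq_det0 l r : seq_det (l ++ 0 :: r) = 0.
Proof.
by have := seq_det_linear 0 0 0 0 l r; rewrite !scale0r addr0 !mul0r addr0.
Qed.

(** Expanding both rows, the terms with a repeated row vanish and the swapped pair contributes a
    minus sign. *)
Lemma seq_det_pair a b c d u v l r :
  seq_det (l ++ [:: a *: u + b *: v, c *: u + d *: v & r]) =
  (a * d - b * c) * seq_det (l ++ [:: u, v & r]).
Proof.
rewrite seq_det_linear -(cat_rcons u) -(cat_rcons v) !seq_det_linear !cat_rcons !seq_det_alternate.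
have -> : seq_det (l ++ [:: v, u & r]) = - seq_det (l ++ [:: u, v & r]).
  apply/eqP; rewrite -addr_eq0; apply/eqP.
  (* Polarization: alternation at u + v gives antisymmetry without dividing by 2. *)
  have := seq_det_alternate (1 *: u + 1 *: v) l r.
  rewrite seq_det_linear -(cat_rcons u) -(cat_rcons v) !seq_det_linear !cat_rcons !seq_det_alternate.
  by rewrite !mul1r add0r addr0 addrC.
ring.
Qed.

Lemma seq_detC u v l r : seq_det (l ++ [:: v, u & r]) = - seq_det (l ++ [:: u, v & r]).
Proof.
have := seq_det_pair 0 1 1 0 u v l r.
by rewrite !scale0r !scale1r add0r addr0 mul0r mul1r sub0r mulN1r.
Qed.

(** Moving the last row to the front costs one sign per row it crosses; these add up to the binomial
    coefficient. *)
Lemma seq_det_rev l r :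
  seq_det (r ++ rev l) = (-1) ^+ 'C(size l, 2) * seq_det (r ++ l).
Proof.
elim: l r => [|v l IHl] r; first by rewrite mul1r.
have mv (s t : seq 'rV[F]_N) :
    seq_det (t ++ rcons s v) = (-1) ^+ size s * seq_det (t ++ v :: s).
  elim: s t => [|u s IHs] t; first by rewrite mul1r.
  by rewrite rcons_cons -cat_rcons IHs cat_rcons seq_detC exprSr mulrN1 mulrN mulNr.
rewrite rev_cons mv -cat_rcons IHl cat_rcons size_rev mulrA -exprD binS bin1.
by rewrite addnC.
Qed.

End ListDet.

(* The vertex with two paths weighs as much as the determinant of the
   one-path block that sends (left, bottom) to (top, right). *)
Definition free_fermion_vertex (F : comNzRingType) (W : bool -> bool -> bool -> bool -> F) :=
  [/\ W false false false false = 1,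
      W true true true true =
        W false true true false * W true false false true -
        W false true false true * W true false true false &
      forall a h b h' : bool, (a + h != b + h')%N -> W a h b h' = 0].

(** The masks keep the rows of occupied edges: (top, right) on the left side, (left, bottom) on the
    right side. Two occupied outputs give the determinant of the block, one gives a linear
    expansion, none the empty vertex of weight 1; conservation removes the other terms. *)
Lemma seq_det_vertex (F : comNzRingType) (N : nat) (W : bool -> bool -> bool -> bool -> F)
    (l r : seq 'rV[F]_N) (u v : 'rV[F]_N) (b h' : bool) :
  free_fermion_vertex W ->
  seq_det (l ++ mask [:: b; h'] [:: W false true true false *: u + W true false true false *: v;
      W false true false true *: u + W true false false true *: v] ++ r) =
  \sum_h \sum_a W a h b h' * seq_det (l ++ mask [:: h; a] [:: u; v] ++ r).
Proof.
move=> [W0 W2 Wc]; rewrite !big_bool /=.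
case: b h' => [] [] /=; rewrite ?seq_det_pair ?seq_det_linear.
- by rewrite [W true false true true]Wc// [W false true true true]Wc//
    [W false false true true]Wc// W2; ring.
- by rewrite [W true true true false]Wc// [W false false true false]Wc//; ring.
- by rewrite [W true true false true]Wc// [W false false false true]Wc//; ring.
- by rewrite [W true true false false]Wc// [W true false false false]Wc//
    [W false true false false]Wc// W0; ring.
Qed.

(** * Transfer through one row, then through all rows *)

Lemma sum_tuple_cons (V : nmodType) (T : finType) (n : nat)
    (P : pred (n.+1.-tuple T)) (f : n.+1.-tuple T -> V) :
  \sum_(t | P t) f t =
  \sum_x \sum_(t : n.-tuple T | P [tuple of x :: t]) f [tuple of x :: t].
Proof.
rewrite pair_big_dep /=.
rewrite (reindex (fun p : T * n.-tuple T => [tuple of p.1 :: p.2])) //=.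
exists (fun t => (thead t, [tuple of behead t])) => [[x t] _|t _] /=.
  by rewrite theadE; congr pair; apply: val_inj.
by rewrite -tuple_eta.
Qed.

Lemma widen_lift0 (n : nat) (i : 'I_n) :
  widen_ord (leqnSn n.+1) (lift ord0 i) = lift ord0 (widen_ord (leqnSn n) i).
Proof. exact: val_inj. Qed.

Lemma lift0_ord_max (n : nat) : lift ord0 (ord_max : 'I_n.+1) = ord_max :> 'I_n.+2.
Proof. exact: val_inj. Qed.

Lemma widen_ord0 (n : nat) : widen_ord (leqnSn n.+1) ord0 = ord0.
Proof. exact: val_inj. Qed.

(** Here [v], [v'] and [u] are the rows attached to the bottom, top and left edges of the columns,
    and [l] holds rows already passed on the left. In the induction on [n] the columns to the right
    of [k] are expanded first; this leaves [v' k] next to [u k.+1], a pair that [seq_det_vertex]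
    trades for [u k] and [v k]. *)
Lemma seq_det_row (F : comNzRingType) (N : nat) (W : nat -> bool -> bool -> bool -> bool -> F)
    (v v' u : nat -> 'rV[F]_N) :
  (forall k, free_fermion_vertex (W k)) ->
  (forall k, v' k = W k false true true false *: u k + W k true false true false *: v k) ->
  (forall k, u k.+1 = W k false true false true *: u k + W k true false false true *: v k) ->
  forall n k l (B : n.-tuple bool),
  seq_det (l ++ mask B [seq v' i | i <- iota k n]) =
  \sum_(A : n.-tuple bool) \sum_(h : n.+1.-tuple bool | ~~ tnth h ord_max)
    (\prod_(i < n) W (k + i)%N (tnth A i) (tnth h (widen_ord (leqnSn n) i))
                     (tnth B i) (tnth h (lift ord0 i))) *
    seq_det (l ++ mask (tnth h ord0 :: A) (u k :: [seq v i | i <- iota k n])).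
Proof.
move=> ffW v'E uE; elim=> [|n IHn] k l B.
  rewrite (big_pred1 [tuple]); last by move=> A; rewrite /= [A]tuple0; apply/esym/eqP.
  rewrite (big_pred1 [tuple false]); last first.
    move=> h; case/tupleP: h => x t; rewrite (_ : ord_max = ord0); last exact: val_inj.
    by rewrite tnth0 /= -val_eqE /= [t]tuple0; case: x.
  by rewrite big_ord0 mul1r tnth0 /=; case: (tval B).
rewrite (tuple_eta B); set b := thead B; set B' := behead_tuple B.
rewrite [iota _ _]/= ![map _ (_ :: _)]/=.
(* The top row of column [k] joins the prefix, so that the induction hypothesis acts on the columns
   from [k.+1] on. *)
have -> : l ++ mask [tuple of b :: B'] (v' k :: [seq v' i | i <- iota k.+1 n]) =
    (l ++ mask [:: b] [:: v' k]) ++ mask B' [seq v' i | i <- iota k.+1 n].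
  by rewrite -catA /=; case: b.
rewrite IHn [RHS]sum_tuple_cons [RHS]exchange_big; apply: eq_bigr => A _ /=.
under eq_bigr => h _.
  have -> : (l ++ mask [:: b] [:: v' k]) ++ mask (tnth h ord0 :: A) 
        (u k.+1 :: [seq v i | i <- iota k.+1 n]) =
      l ++ mask [:: b; tnth h ord0] [:: v' k; u k.+1] ++ mask A [seq v i | i <- iota k.+1 n].
    by rewrite -catA /=; case: b (tnth h ord0) => [] [].
  rewrite v'E uE (seq_det_vertex _ _ _ _ _ _ (ffW k)) big_distrr;
    under eq_bigr do rewrite big_distrr; over.
rewrite exchange_big.
under [RHS]eq_bigr do rewrite sum_tuple_cons.
rewrite [RHS]exchange_big; apply: eq_bigr => h _.
rewrite exchange_big; apply: eq_bigr => a _ /=.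
apply: eq_big => [h'|h' _]; first by rewrite -lift0_ord_max tnthS.
rewrite big_ord_recl addn0 !tnth0 widen_ord0 tnth0 tnthS.
rewrite [X in _ = X * _]mulrC -mulrA [RHS]mulrC -[RHS]mulrA.
rewrite [LHS]mulrCA; congr (_ * _); rewrite [LHS]mulrC; congr (_ * _).
  by case: h a => [] [].
apply: eq_bigr => i _.
by rewrite widen_lift0 !tnthS lift0 addSnnS.
Qed.

(** A product of transfer matrices written as a sum over sequences of states. The induction shifts
    the chain by one and splits off its first step. *)
Lemma sum_paths (F : comNzRingType) (S : finType) (M : nat)
    (T : 'I_M -> S -> S -> F) (q : nat -> S -> F) :
  (forall (j : 'I_M) B, q j.+1 B = \sum_A q j A * T j A B) ->
  forall B, q M B = \sum_(v : M.+1.-tuple S | tnth v ord_max == B)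
    q 0%N (tnth v ord0) *
    \prod_(j < M) T j (tnth v (widen_ord (leqnSn M) j)) (tnth v (lift ord0 j)).
Proof.
elim: M => [|M IHM] in T q *; move=> qS B.
  rewrite (big_pred1 [tuple B]); first by rewrite big_ord0 mulr1 tnth0.
  move=> v; case/tupleP: v => x t; rewrite (_ : ord_max = ord0); last exact: val_inj.
  by rewrite tnth0 /= -val_eqE /= [t]tuple0 eqseq_cons andbT.
rewrite (IHM (fun j => T (lift ord0 j)) (fun j => q j.+1)); last first.
  by move=> j A; have := qS (lift ord0 j) A; rewrite lift0.
rewrite [RHS]sum_tuple_cons.
under [RHS]eq_bigr => x _.
  rewrite (eq_bigl (fun v : M.+1.-tuple S => tnth v ord_max == B)); first over.
  by move=> v; rewrite -lift0_ord_max tnthS.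
rewrite [RHS]exchange_big; apply: eq_bigr => v _ /=.
rewrite (qS ord0) big_distrl; apply: eq_bigr => x _ /=.
rewrite big_ord_recl !tnth0 widen_ord0 tnth0 tnthS mulrA; congr (_ * _).
by apply: eq_bigr => j _; rewrite widen_lift0 !tnthS.
Qed.

(** * Finite form of the partition function *)

Section PartitionFunction.
Variables (R : realType) (N M : nat) (lam : N.-tuple nat).
Local Notation C := R[i].
Variables (w theta : 'I_M -> C) (y s : nat -> C).

Lemma config_weightE (c : config M) (l : C) :
  (\forall n \near \oo, \prod_(i < n) column_weight w y theta s c i = l) ->
  config_weight w y theta s c = l.
Proof. by move=> cl; exact: (@lim_near_cst C^o (@norm_hausdorff _ C^o) _ _ _ l _ cl). Qed.

Lemma config_weight_finite (c : config M) (n : nat) :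
  (forall i, (n <= i)%N -> column_weight w y theta s c i = 1) ->
  config_weight w y theta s c = \prod_(i < n) column_weight w y theta s c i.
Proof.
move=> c1; apply: config_weightE; exists n => // k /= nk.
rewrite -(subnKC nk) big_split_ord /= [X in _ * X]big1 ?mulr1// => i _.
by rewrite c1// leq_addr.
Qed.

Lemma config_weight_eq0 (c : config M) (i : nat) :
  column_weight w y theta s c i = 0 -> config_weight w y theta s c = 0.
Proof.
move=> ci; apply: config_weightE; exists i.+1 => // k /= ik.
by rewrite (bigD1 (Ordinal ik)) //= ci mul0r.
Qed.

Lemma vertex_weight_out0 (a h : bool) (x y0 r s0 : C) :
  vertex_weight a h false false x y0 r s0 != 0 -> a = false /\ h = false.
Proof. by case: a h => [] [] //=; rewrite eqxx. Qed.

(** * Truncation to a window of [n] columns *)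

Variable n : nat.
Hypothesis N_le_n : (N <= n)%N.
Hypothesis sig_lt_n : forall i, (sig_pos lam i < n)%N.

Lemma sig_columns_lt (i : nat) : i \in sig_columns lam -> (i < n)%N.
Proof. by move=> /codomP[k ->]. Qed.

(** In a column beyond the window the top edge is empty. If its right edges are empty too,
    conservation at each vertex, from the top down, empties the vertical edges and then the left
    edges. Starting from the columns where all horizontal edges are empty, this propagates leftwards
    to column [n]. *)
Lemma support_config (c : config M) : admissible lam c ->
  config_weight w y theta s c != 0 ->
  forall i, (n <= i)%N ->
    (forall j, c.1 i j = false) /\ (forall j, c.2 i j = false).
Proof.
move=> [_ ctop _ [K _ cK]] cw0.
have vw i j : vertex_weight (c.1 i (widen_ord (leqnSn M) j)) (c.2 i j)
    (c.1 i (lift ord0 j)) (c.2 i.+1 j) (w j) (y i) (theta j) (s i) != 0.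
  have : column_weight w y theta s c i != 0.
    by apply: contra_neq cw0 => /config_weight_eq0.
  by move=> /prodf_neq0; apply.
have col i : (n <= i)%N -> (forall j, c.2 i.+1 j = false) ->
    (forall j, c.1 i j = false) /\ (forall j, c.2 i j = false).
  move=> ni ci1.
  have v0 k (j : 'I_M.+1) : (j + k)%N = M -> c.1 i j = false.
    elim: k j => [|k IHk] j jk.
      have -> : j = ord_max by apply: val_inj; move: jk; rewrite addn0.
      by rewrite ctop; apply: contraTF ni => /sig_columns_lt; rewrite -ltnNge.
    have jM : (j < M)%N by rewrite -[ltnRHS]jk addnS ltnS leq_addr.
    have := vw i (Ordinal jM); rewrite ci1 (IHk (lift ord0 (Ordinal jM))); last first.
      by rewrite lift0 /= addSnnS.
    move=> /vertex_weight_out0[+ _].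
    by rewrite (_ : widen_ord _ _ = j)//; apply: val_inj.
  have v1 (j : 'I_M.+1) : c.1 i j = false.
    by apply: (v0 (M - j)%N); rewrite subnKC// -ltnS.
  split=> // j; have := vw i j.
  by rewrite ci1 v1 v1 => /vertex_weight_out0[].
(* [d] bounds the number of columns left to cross before the threshold [K]. *)
have h0 d i : (n <= i)%N -> (K <= i + d)%N -> forall j, c.2 i j = false.
  elim: d i => [|d IHd] i ni; first by rewrite addn0 => /cK.
  rewrite addnS -addSn => Ki.
  by have [] := col i ni (IHd i.+1 (leqW ni) Ki).
by move=> i ni; apply: col => //; apply: (h0 K); rewrite ?leq_addl// leqW.
Qed.

(** Rows are the outer index, unlike in [config], so that the states at one height form one tuple.
    Horizontal states form a finite function of the row, the shape needed to distribute a product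
    over sums. *)
Definition lattice_state : Type :=
  (M.+1.-tuple (n.-tuple bool) * {ffun 'I_M -> n.+1.-tuple bool})%type.

(** The default value of [nth] leaves every edge outside the window empty. *)
Definition config_of (p : lattice_state) : config M :=
  (fun i j => nth false (tnth p.1 j) i, fun i j => nth false (p.2 j) i).

Definition bottom_state : n.-tuple bool := [tuple (i < N)%N | i < n].
Definition top_state : n.-tuple bool := [tuple (val i) \in sig_columns lam | i < n].
Definition closed_row (h : n.+1.-tuple bool) : bool :=
  ~~ tnth h ord0 && ~~ tnth h ord_max.

Definition admissible_state (p : lattice_state) : bool :=
  [&& tnth p.1 ord0 == bottom_state, tnth p.1 ord_max == top_state &
      p.2 \in ffun_on closed_row].

Lemma config_of_inj : injective config_of.
Proof.
move=> [v h] [v' h'] [/= vv' hh']; congr (_, _).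
  apply: eq_from_tnth => j; apply: eq_from_tnth => i.
  by rewrite !(tnth_nth false) (congr1 (fun f => f (val i) j) vv').
apply/ffunP => j; apply: eq_from_tnth => i.
by rewrite !(tnth_nth false) (congr1 (fun f => f (val i) j) hh').
Qed.

Lemma config_of_out (p : lattice_state) (i : nat) : admissible_state p -> (n <= i)%N ->
  (forall j, (config_of p).1 i j = false) /\ (forall j, (config_of p).2 i j = false).
Proof.
move=> /and3P[_ _ /ffun_onP hp] ni; split=> j; first by rewrite /= nth_default// size_tuple.
move: ni; rewrite leq_eqVlt => /predU1P[<-|ni]; last by rewrite /= nth_default// size_tuple.
by have /andP[_] := hp j; rewrite (tnth_nth false) => /negbTE.
Qed.

Lemma config_of_admissible (p : lattice_state) : admissible_state p ->
  admissible lam (config_of p).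
Proof.
move=> pP; have /and3P[/eqP p0 /eqP pM /ffun_onP hp] := pP; split.
- move=> i; rewrite /= p0; have [ni|ni] := ltnP i n.
    by rewrite -(tnth_nth _ _ (Ordinal ni)) tnth_mktuple.
  by rewrite nth_default ?size_tuple// ltnNge (leq_trans N_le_n ni).
- move=> i; rewrite /= pM; have [ni|ni] := ltnP i n.
    by rewrite -(tnth_nth _ _ (Ordinal ni)) tnth_mktuple.
  rewrite nth_default ?size_tuple//; apply/esym; apply: contraTF ni => /sig_columns_lt.
  by rewrite -ltnNge.
- by move=> j; have /andP[+ _] := hp j; rewrite (tnth_nth false) => /negbTE.
- by exists n => // i /= ni j; have [_ hout] := config_of_out pP ni; exact: hout.
Qed.

Lemma admissible_config_of (c : config M) : admissible lam c ->
  config_weight w y theta s c != 0 ->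
  exists2 p, admissible_state p & config_of p = c.
Proof.
move=> cP cw0; have cout := support_config cP cw0.
have [c0 cM cl _] := cP.
exists ([tuple [tuple c.1 (val i) j | i < n] | j < M.+1],
        [ffun j => [tuple c.2 (val i) j | i < n.+1]]).
  apply/and3P; split=> /=.
  - by rewrite tnth_mktuple; apply/eqP/eq_from_tnth => i; rewrite !tnth_mktuple c0.
  - by rewrite tnth_mktuple; apply/eqP/eq_from_tnth => i; rewrite !tnth_mktuple cM.
  - apply/ffun_onP => j; rewrite ffunE unfold_in /closed_row !tnth_mktuple cl /=.
    by have [_ ->] := cout n (leqnn n).
case: c {cP cw0 c0 cM cl} cout => v h cout; congr (_, _); apply/funext => i; apply/funext => j /=.
  rewrite tnth_mktuple; have [ni|ni] := ltnP i n.
    by rewrite -(tnth_nth _ _ (Ordinal ni)) tnth_mktuple.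
  by rewrite nth_default ?size_tuple//; have [/= ->] := cout i ni.
rewrite ffunE; have [ni|ni] := ltnP i n.+1.
  by rewrite -(tnth_nth _ _ (Ordinal ni)) tnth_mktuple.
by rewrite nth_default ?size_tuple//; have [_ /= ->] := cout i (ltnW ni).
Qed.

Lemma config_weight_of (p : lattice_state) : admissible_state p ->
  config_weight w y theta s (config_of p) =
  \prod_(j < M) \prod_(i < n)
    vertex_weight (tnth (tnth p.1 (widen_ord (leqnSn M) j)) i)
      (tnth (p.2 j) (widen_ord (leqnSn n) i))
      (tnth (tnth p.1 (lift ord0 j)) i) (tnth (p.2 j) (lift ord0 i))
      (w j) (y i) (theta j) (s i).
Proof.
move=> pP; rewrite (@config_weight_finite _ n).
  rewrite exchange_big; apply: eq_bigr => i _; apply: eq_bigr => j _ /=.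
  by rewrite !(tnth_nth false).
move=> i ni; apply: big1 => j _.
have [v0 h0] := config_of_out pP ni; have [_ h1] := config_of_out pP (leqW ni).
by rewrite !v0 h0 h1.
Qed.

(** Admissible configurations not coming from a finite state have weight 0. Given the vertical
    edges, the rows are independent, so the sum over horizontal edges factors row by row. *)
Lemma partition_functionE :
  partition_function lam w y theta s =
  \sum_(v : M.+1.-tuple (n.-tuple bool) |
         (tnth v ord_max == top_state) && (tnth v ord0 == bottom_state))
    \prod_(j < M) \sum_(h : n.+1.-tuple bool | closed_row h)
      \prod_(i < n)
        vertex_weight (tnth (tnth v (widen_ord (leqnSn M) j)) i)
          (tnth h (widen_ord (leqnSn n) i))
          (tnth (tnth v (lift ord0 j)) i) (tnth h (lift ord0 i))
          (w j) (y i) (theta j) (s i).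
Proof.
rewrite /partition_function.
rewrite -(@fsbig_widen _ _ _ _ (config_of @` [set p | admissible_state p])); first last.
- move=> c [/= cP cN]; apply/eqP; apply/negPn/negP => cw0; apply: cN.
  by have [p pP pc] := admissible_config_of cP cw0; exists p.
- by move=> c /= [p pP <-]; exact: config_of_admissible.
rewrite fsbig_image; last by move=> p q _ _; exact: config_of_inj.
rewrite (@fsbigE _ _ _ _ _ (enum admissible_state)) ?enum_uniq//; first last.
- by move=> p pP /negP[]; rewrite mem_enum; exact: pP.
- by move=> p /=; rewrite mem_enum.
rewrite big_enum_cond (eq_bigl admissible_state); last first.
  by move=> p; rewrite andb_idr// => pP; apply: mem_set.
under [RHS]eq_bigr do rewrite bigA_distr_big.
rewrite pair_big_dep /=; apply: eq_big => [p|p pP]; last exact: config_weight_of.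
by rewrite /admissible_state andbA; congr (_ && _); rewrite andbC.
Qed.

End PartitionFunction.

(** * The determinantal formula *)

Lemma seq_det_mem0 (F : comNzRingType) (N : nat) (l : seq 'rV[F]_N) :
  0 \in l -> seq_det l = 0.
Proof. by move=> /splitPr[l1 l2]; exact: seq_det0. Qed.

Lemma mask_iota (n : nat) (A : n.-tuple bool) :
  mask A (iota 0 n) = [seq k <- iota 0 n | nth false A k].
Proof.
rewrite [LHS]mask_filter ?iota_uniq//; apply: eq_in_filter => k; rewrite mem_iota /= => kn.

have kE : index k (iota 0 n) = k.
  have := @index_uniq _ 0%N k (iota 0 n); rewrite nth_iota// add0n size_iota.
  by apply; rewrite ?iota_uniq.
by rewrite in_mask ?iota_uniq// kE mem_iota /= kn.
Qed.

Lemma free_fermion_vertex_weight (R : realType) (x y r s : R[i]) :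
  s ^- 2 * y - x != 0 ->
  free_fermion_vertex (fun a h b h' => vertex_weight a h b h' x y r s).
Proof.
move=> sx; split=> //=; last by do 4!case.
(* The identity is polynomial in the two inverse squares up to the common denominator, so they
   become free letters. *)
by move: (s ^- 2) (r ^- 2) sx => S T sx; field.
Qed.

(** * The columns of a signature *)

Section Signature.
Variables (N : nat) (lam : N.-tuple nat).
Hypothesis lam_sig : sorted geq lam.

Lemma sig_pos_decreasing (i j : 'I_N) : (i < j)%N -> (sig_pos lam j < sig_pos lam i)%N.
Proof.
move=> ij; have lamij : (tnth lam j <= tnth lam i)%N.
  rewrite !(tnth_nth 0%N); apply: (sorted_leq_nth _ _ _ lam_sig); rewrite ?inE ?size_tuple//.
  - by move=> a b c ba cb; exact: leq_trans cb ba.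
  - exact: leqnn.
  - exact: ltnW.
rewrite /sig_pos -addnS leq_add// ltn_sub2l//.
exact: leq_ltn_trans ij (ltn_ord j).
Qed.

Lemma sig_columns_sorted : sorted gtn (sig_columns lam).
Proof.
rewrite /sig_columns codomE sorted_map.
apply: (@sub_sorted _ (relpre val ltn)); first by move=> i j; exact: sig_pos_decreasing.
by rewrite -sorted_map val_enum_ord iota_ltn_sorted.
Qed.

(** Both lists are strictly increasing with the same members. The reversal, due to the signature
    listing its columns in decreasing order, is the source of the sign in the determinant. *)
Lemma filter_sig_columns (n : nat) : (forall i, sig_pos lam i < n)%N ->
  [seq k <- iota 0 n | k \in sig_columns lam] = rev (sig_columns lam).
Proof.
move=> lamn; apply: (irr_sorted_eq ltn_trans ltnn).
- by apply: (sorted_filter ltn_trans); exact: iota_ltn_sorted.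
- by rewrite rev_sorted; exact: sig_columns_sorted.
move=> k; rewrite mem_filter mem_rev mem_iota add0n /= andb_idr//.
by move=> /codomP[i ->].
Qed.

End Signature.

(** * Minors of the contour functions as amplitudes of states *)

Section Determinant.
Variables (R : realType) (N M : nat) (lam : N.-tuple nat) (gam : contour R).
Local Notation C := R[i].
Variables (w theta : 'I_M -> C) (y s : nat -> C).
Hypothesis lam_sig : sorted geq lam.
Hypothesis weight_den : forall i j, s i ^- 2 * y i - w j != 0.
Hypothesis gam_y : forall i, surrounds gam (y i).
Hypothesis gam_w : forall j, surrounds gam (w j).
Hypothesis gam_sy : forall i, leaves_out gam (s i ^- 2 * y i).

Definition hrow (j k : nat) : 'rV[C]_N := \row_m hfun_rows gam w theta y s j k m.

Lemma hrow0_eq0 (k : nat) : (N <= k)%N -> hrow 0 k = 0.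
Proof.
move=> Nk; apply/rowP => m; rewrite !mxE hfun_rows0// psiE /blaschke.
have mk : (m < k)%N := leq_trans (ltn_ord m) Nk.
by rewrite (bigD1 (Ordinal mk)) //= subrr !mul0r mulr0 oppr0.
Qed.

(** At y_k the leading factor of psi_k equals -1; its denominator is nonzero because a surrounded
    point differs from one left out. *)
Lemma psi_diag (k : nat) :
  - psi k (y k) y s = \prod_(i < k) ((y k - y i) / (y k - s i ^- 2 * y i)).
Proof.
rewrite psiE /blaschke -mulNr -[RHS]mul1r; congr (_ * _).
have := surrounds_sub_sy_neq0 gam_y gam_sy k k.
move: (s k ^- 2) (y k) => S Y; rewrite -[in X in X -> _](opprB _ Y) oppr_eq0 => YS.
have -> : Y * (S - 1) = S * Y - Y by ring.
by rewrite -mulrN -invrN opprB divff.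
Qed.

Lemma seq_det_hrow0 :
  seq_det [seq hrow 0 k | k <- iota 0 N] =
  \prod_(k < N) \prod_(i < N | (i < k)%N) ((y k - y i) / (y k - s i ^- 2 * y i)).
Proof.
(* The entries below the diagonal vanish, while [det_trig] treats lower triangular matrices; hence
   the transposition. *)
rewrite /seq_det size_map size_iota eqxx -det_tr det_trig.
  apply: eq_bigr => k _; rewrite !mxE (nth_map 0%N) ?size_iota// nth_iota// mxE hfun_rows0//.
  rewrite psi_diag.
  by apply: (big_ord_widen N (fun i => (y k - y i) / (y k - s i ^- 2 * y i)));
    exact: ltnW (ltn_ord k).
apply/is_trig_mxP => i j ij.
rewrite !mxE (nth_map 0%N) ?size_iota// nth_iota// mxE hfun_rows0// psiE /blaschke.
by rewrite (bigD1 (Ordinal ij)) //= subrr !mul0r mulr0 oppr0.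
Qed.

Lemma seq_det_hrow_sig :
  seq_det [seq hrow M k | k <- sig_columns lam] =
  \det (\matrix_(i < N, j < N) hfun gam (sig_pos lam i) j w y theta s).
Proof.
rewrite /seq_det size_map size_codom card_ord eqxx; congr (\det _).
apply/matrixP => i j; rewrite !mxE /sig_columns codomE -map_comp.
rewrite (nth_map i) ?size_enum_ord// nth_ord_enum mxE /=.
apply: eq_cint => z _; rewrite mulrA; congr (_ * _).
by apply: eq_bigl => k; rewrite ltn_ord.
Qed.

Variable n : nat.
Hypothesis N_le_n : (N <= n)%N.
Hypothesis sig_lt_n : forall i, (sig_pos lam i < n)%N.

(** The [N]-path amplitude of the occupation state [A] below row [j], as a Slater determinant of
    one-path amplitudes. *)
Definition fock (j : nat) (A : n.-tuple bool) : C :=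
  seq_det (mask A [seq hrow j k | k <- iota 0 n]).

Lemma fock_step (j : 'I_M) (B : n.-tuple bool) :
  fock j.+1 B = \sum_A fock j A * \sum_(h : n.+1.-tuple bool | closed_row h)
      \prod_(i < n) vertex_weight (tnth A i) (tnth h (widen_ord (leqnSn n) i))
        (tnth B i) (tnth h (lift ord0 i)) (w j) (y i) (theta j) (s i).
Proof.
pose W k a h b h' := vertex_weight a h b h' (w j) (y k) (theta j) (s k).
pose u k : 'rV[C]_N := \row_m travel_rows gam w theta y s j k m.
have ffW k : free_fermion_vertex (W k) by exact: free_fermion_vertex_weight.
have hrowS k : hrow j.+1 k =
    W k false true true false *: u k + W k true false true false *: hrow j k.
  by apply/rowP => m; rewrite !mxE hfun_rowsS.
have uS k : u k.+1 =
    W k false true false true *: u k + W k true false false true *: hrow j k.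
  by apply/rowP => m; rewrite !mxE travel_rowsS.
have u0 : u 0%N = 0 by apply/rowP => m; rewrite !mxE travel_rows0.
rewrite /fock (seq_det_row ffW hrowS uS 0 [::]) /=; apply: eq_bigr => A _.
rewrite big_distrr /= [LHS]big_mkcond [RHS]big_mkcond /=; apply: eq_bigr => h _.
(* [seq_det_row] closes only the right end. A path entering on the left would put the zero row [u 0]
   into the determinant. *)
rewrite /closed_row andbC; case: ifP => //= _; rewrite u0; case: (tnth h ord0) => /=.
  by rewrite (seq_det0 [::]) mulr0.
by rewrite mulrC.
Qed.

(** A nonzero minor needs exactly [N] occupied columns, none of them at or beyond [N] since those
    rows vanish; the first [N] columns are the only choice. *)
Lemma fock0 (A : n.-tuple bool) :
  fock 0 A = (fock 0 (bottom_state N n)) *+ (A == bottom_state N n).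
Proof.
have [->//|Ab] := eqVneq A; rewrite mulr0n; apply/eqP; apply: contra_neqT Ab => fA.
set I := mask A (iota 0 n).
have fI : fock 0 A = seq_det [seq hrow 0 k | k <- I] by rewrite /fock -map_mask.
have IltN k : k \in I -> (k < N)%N.
  move=> kI; rewrite ltnNge; apply: contra fA => Nk; rewrite fI seq_det_mem0//.
  by rewrite -(hrow0_eq0 Nk); exact: map_f.
have sI : size I = N.
  apply/eqP; apply: contraNT fA => sI.
  by rewrite fI /seq_det size_map (negbTE sI).
have uI : uniq I by apply: mask_uniq; exact: iota_uniq.
have subI : {subset I <= iota 0 N} by move=> k /IltN; rewrite mem_iota.
have [_ IE] : (size I = size (iota 0 N)) * (I =i iota 0 N).
  by apply: uniq_min_size => //; rewrite size_iota sI.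
apply: eq_from_tnth => i; rewrite tnth_mktuple (tnth_nth false).
by have := IE i; rewrite /I mask_iota mem_filter !mem_iota /= ltn_ord andbT.
Qed.

Lemma fock_top : fock M (top_state lam n) =
  (-1) ^+ 'C(N, 2) * \det (\matrix_(i < N, j < N) hfun gam (sig_pos lam i) j w y theta s).
Proof.
rewrite -seq_det_hrow_sig /fock -map_mask mask_iota.
rewrite (eq_in_filter (a2 := fun k => k \in sig_columns lam)); last first.
  move=> k; rewrite mem_iota add0n => /andP[_ kn].
  by rewrite -(tnth_nth _ _ (Ordinal kn)) tnth_mktuple.
rewrite filter_sig_columns// map_rev -[rev _]cat0s seq_det_rev.
by rewrite size_map size_codom card_ord.
Qed.

Lemma fock_bottom : fock 0 (bottom_state N n) =
  \prod_(k < N) \prod_(i < N | (i < k)%N) ((y k - y i) / (y k - s i ^- 2 * y i)).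
Proof.
rewrite -seq_det_hrow0 /fock -map_mask mask_iota; congr (seq_det (map _ _)).
rewrite (eq_in_filter (a2 := fun k => (k < N)%N)); last first.
  move=> k; rewrite mem_iota add0n => /andP[_ kn].
  by rewrite -(tnth_nth _ _ (Ordinal kn)) tnth_mktuple.
rewrite -[in iota 0 n](subnKC N_le_n) iotaD filter_cat add0n.
rewrite (_ : [seq k <- iota 0 N | _] = iota 0 N).
  rewrite (_ : [seq k <- iota N _ | _] = [::]) ?cats0//.
  apply/eqP; rewrite -[_ == _]negbK -has_filter -all_predC.
  by apply/allP => k; rewrite mem_iota /= -leqNgt => /andP[].
by apply/all_filterP/allP => k; rewrite mem_iota.
Qed.

(** Iterating [fock_step] over the rows gives a sum over all initial states, of which [fock0] keeps
    one. *)
Lemma fock_partition_function :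
  fock M (top_state lam n) = fock 0 (bottom_state N n) * partition_function lam w y theta s.
Proof.
rewrite (sum_paths fock_step) (partition_functionE _ _ _ _ N_le_n sig_lt_n).
rewrite big_distrr [RHS]big_mkcondr; apply: eq_bigr => v _.
by rewrite fock0; case: eqP => // _; rewrite mul0r.
Qed.

End Determinant.

Theorem proposition1p7 (R : realType) (N M : nat) (lam : N.-tuple nat)
    (w theta : 'I_M -> R[i]) (y s : nat -> R[i]) (gam : contour R)
    (N_gt0 : (0 < N)%N)
    (lam_sig : sorted geq lam)
    (s_neq0 : forall i, s i != 0)
    (theta_neq0 : forall j, theta j != 0)
    (weight_den : forall i j, s i ^- 2 * y i - w j != 0)
    (y_neq : forall i j, (i < j < N)%N -> y j - y i != 0)
    (gam_y : forall i, surrounds gam (y i))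
    (gam_w : forall j, surrounds gam (w j))
    (gam_sy : forall i, leaves_out gam (s i ^- 2 * y i)) :
  partition_function lam w y theta s =
  (\prod_(i < N) \prod_(j < N | (i < j)%N)
     ((s i ^- 2 * y i - y j) / (y j - y i))) *
  \det (\matrix_(i < N, j < N) hfun gam (sig_pos lam i) j w y theta s).
Proof.
set pref := \prod_(i < N) _; set D := \det _; set Z := partition_function _ _ _ _ _.
have sign2 : (-1) ^+ 'C(N, 2) * (-1) ^+ 'C(N, 2) = 1 :> R[i].
  by rewrite -expr2 sqrr_sign.
(* A window wide enough for the initial columns and for every column of the signature. *)
pose n := (N + \sum_(i < N) tnth lam i)%N.
have N_le_n : (N <= n)%N by exact: leq_addr.
have sig_lt_n i : (sig_pos lam i < n)%N.
  rewrite /sig_pos /n addnC -addSn leq_add//.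
    by rewrite -subSn ?ltn_ord// subSS leq_subr.
  by rewrite (bigD1 i)//= leq_addr.
have -> : D = (-1) ^+ 'C(N, 2) * fock N gam w theta y s M (top_state lam n).
  by rewrite fock_top// mulrA sign2 mul1r.
rewrite (fock_partition_function theta weight_den gam_y gam_w gam_sy N_le_n sig_lt_n) -/Z.
rewrite fock_bottom// !mulrA.
rewrite (_ : pref * _ * _ = 1) ?mul1r//.
rewrite mulrAC -[RHS]sign2; congr (_ * _).
(* The binomial exponent is the sum of all k < N, which provides one sign for each pair i < k. *)
rewrite /pref (exchange_big_dep xpredT)//= -big_split /=.
rewrite -bin2_sum big_mkord -prodrXr /=; apply: eq_bigr => k _.
rewrite -big_split /=.
under eq_bigr => i ik.
  (* For each pair the two fractions multiply to -1. *)
  have yki : y k - y i != 0 by apply: y_neq; rewrite ik ltn_ord.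
  have yks := surrounds_sub_sy_neq0 gam_y gam_sy k i.
  rewrite mulrA mulfVK// -opprB mulNr divff//.
  over.
rewrite -(big_ord_widen N (fun=> -1))//; last exact: ltnW (ltn_ord k).
by rewrite prodr_const card_ord.
Qed.
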